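(* Let $d\ge 2$, $k\ge 2$, let $\Omega\subset\mathbb R^d$ be a bounded open connected set, and let $\tau>0$ be given. Let $(\varphi^s,u^s)$ ($s=0,1,2,\dots$) be a sequence generated by Algorithm 1 or by Algorithm 2 (both described in the context) from an initial $u^0\in B$. Then $$E^\tau(\varphi^{s+1},u^{s+1})\le E^\tau(\varphi^{s},u^{s})$$ for every $s$.
   Context: $[k]=\{1,\dots,k\}$, and $\|\cdot\|_2$ is the $L^2(\Omega)$ norm. For $v\in L^2(\Omega)$ and $\tau>0$, $e^{\frac{\tau}{2}\Delta}v$ denotes the solution at time $t=\tau/2$ of the free-space heat equation $\partial_t w=\Delta w$ on $\mathbb R^d$ with initial datum $v$ (extended by $0$ outside $\Omega$), i.e. $e^{\frac{\tau}{2}\Delta}v=G_{\tau/2}*v$ with $G_\tau(x)=(4\pi\tau)^{-d/2}\exp(-|x|^2/(4\tau))$; when regarded as an operator on $L^2(\Omega)$, the result is restricted to $\Omega$. $K$ is the set of $k$-tuples $\varphi=(\varphi_1,\dots,\varphi_k)$ of measurable functions on $\Omega$ with $\varphi_\ell(x)\in[0,1]$ and $\sum_{\ell\in[k]}\varphi_\ell(x)=1$ for a.e. $x\in\Omega$. $B=\{u=(u_1,\dots,u_k)\in L^2(\Omega,\mathbb R^k):\ \|u_\ell\|_2=1\ \text{for all }\ell\in[k]\}$. The relaxed energy is $$E^\tau(\varphi,u)=\frac{k}{\tau}-\sum_{\ell\in[k]}\frac1\tau\int_\Omega\varphi_\ell\,|e^{\frac{\tau}{2}\Delta}u_\ell|^2\,dx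 .$$ Both algorithms start from $u^0\in B$ and, given $u^s$, first compute $u^*_\ell=e^{\frac{\tau}{2}\Delta}u^s_\ell$ and then set $$\varphi^s_\ell(x)=\begin{cases}1 & \text{if } \ell=\min\{\arg\max_{i\in[k]}|u^*_i(x)|^2\},\\ 0&\text{otherwise.}\end{cases}$$ Algorithm 1: $u^{s+1}$ is defined by $$u^{s+1}_\ell=\frac{e^{\frac{\tau}{2}\Delta}(\varphi^s_\ell\, e^{\frac{\tau}{2}\Delta}u^s_\ell)}{\|e^{\frac{\tau}{2}\Delta}(\varphi^s_\ell\, e^{\frac{\tau}{2}\Delta}u^s_\ell)\|_2},\qquad \ell\in[k].$$ Algorithm 2: with a fixed tolerance $tol>0$, set $\hat u^{s,0}=u^s$ and iterate $$\hat u^{s,m+1}_\ell=\frac{e^{\frac{\tau}{2}\Delta}(\varphi^s_\ell\, e^{\frac{\tau}{2}\Delta}\hat u^{s,m}_\ell)}{\|e^{\frac{\tau}{2}\Delta}(\varphi^s_\ell\, e^{\frac{\tau}{2}\Delta}\hat u^{s,m}_\ell)\|_2},\qquad \ell\in[k],\quad m=0,1,2,\dots$$ until two successive iterates differ in $L^2$ norm by less than $tol$; then $u^{s+1}$ is the last iterate computed. The iterations are understood to be well defined, i.e. the denominators that occur are nonzero. *)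

(* Defs.v *)
From HB Require Import structures.
From mathcomp Require Import all_boot all_order all_algebra.
From mathcomp Require Import all_classical all_reals all_analysis.

Set Implicit Arguments.
Unset Strict Implicit.
Unset Printing Implicit Defensive.

Import Order.TTheory GRing.Theory Num.Theory.
Import numFieldNormedType.Exports.

Local Open Scope classical_set_scope.
Local Open Scope ring_scope.

(* 'rV[R]_n carries the sigma-algebra generated by the coordinates, i.e. the
   Borel sigma-algebra of R^n. *)
Definition rV_display : measure_display.
Proof. exact: default_measure_display. Qed.

Section measurable_rV.
Variables (R : realType) (n : nat).

Definition rV_coord (i : 'I_n) (x : 'rV[R]_n) : measurableTypeR R := x ord0 i.

Let rV_set0 : g_sigma_preimage rV_coord set0.
Proof. exact: sigma_algebra0. Qed.

Let rV_setC A : g_sigma_preimage rV_coord A -> g_sigma_preimage rV_coord (~` A).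
Proof. exact: sigma_algebraC. Qed.

Let rV_bigcup (F : (set 'rV[R]_n)^nat) :
  (forall i, g_sigma_preimage rV_coord (F i)) ->
  g_sigma_preimage rV_coord (\bigcup_i (F i)).
Proof. exact: sigma_algebra_bigcup. Qed.

HB.instance Definition _ := @isMeasurable.Build
  rV_display 'rV[R]_n (g_sigma_preimage rV_coord)
  rV_set0 rV_setC rV_bigcup.

Lemma measurable_rV_coord i : measurable_fun [set: 'rV[R]_n] (rV_coord i).
Proof.
move=> _ Y mY; rewrite setTI; apply: sub_sigma_algebra => /=.
rewrite -bigcup_seq/=; exists i => /=; first by rewrite mem_index_enum.
by exists Y => //; rewrite setTI.
Qed.

Lemma measurable_fun_rVP d (T : measurableType d) (f : T -> 'rV[R]_n) :
  (forall i, measurable_fun [set: T] (rV_coord i \o f)) ->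
  measurable_fun [set: T] f.
Proof.
move=> mf _ A mA.
suff: g_sigma_preimage (fun i => rV_coord i \o f) `<=` measurable.
  apply; rewrite g_sigma_preimage_comp; exists A => //.
apply: smallest_sub; first exact: sigma_algebra_measurable.
rewrite -bigcup_seq; apply: bigcup_sub => i _.
by move=> B [C mC <-]; exact: mf.
Qed.

End measurable_rV.

Section lebesgue_rV.
Variable R : realType.

Definition rV_cons n (p : measurableTypeR R * 'rV[R]_n) : 'rV[R]_n.+1 :=
  \row_i if unlift ord0 i is Some j then p.2 ord0 j else p.1.

Definition rV_uncons n (x : 'rV[R]_n.+1) : measurableTypeR R * 'rV[R]_n :=
  (x ord0 ord0, \row_j x ord0 (lift ord0 j)).

Lemma rV_consK n : cancel (@rV_cons n) (@rV_uncons n).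
Proof.
case=> a x; rewrite /rV_uncons /rV_cons mxE unlift_none; congr pair.
by apply/rowP => j; rewrite !mxE liftK.
Qed.

Lemma measurable_rV_cons n : measurable_fun setT (@rV_cons n).
Proof.
apply: measurable_fun_rVP => i.
rewrite (_ : _ \o _ = fun p =>
    if unlift ord0 i is Some j then rV_coord j p.2 else p.1); last first.
  by apply/funext => p; rewrite /= /rV_coord mxE.
case: (unlift ord0 i) => [j|]; last exact: measurable_fst.
exact: (measurableT_comp (measurable_rV_coord j) measurable_snd).
Qed.

Lemma measurable_rV_uncons n : measurable_fun setT (@rV_uncons n).
Proof.
apply/measurable_fun_pairP; split.
  exact: (measurable_rV_coord (ord0 : 'I_n.+1)).
apply: measurable_fun_rVP => i.
rewrite (_ : _ \o _ = rV_coord (lift ord0 i)).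
  exact: measurable_rV_coord.
by apply/funext => x; rewrite /= /rV_coord mxE.
Qed.

Section step.
Variables (n : nat) (m : {sigma_finite_measure set 'rV[R]_n -> \bar R}).
Local Open Scope ereal_scope.

Definition lebesgue_rV_step : set 'rV[R]_n.+1 -> \bar R :=
  pushforward (@lebesgue_measure R \x m) (@rV_cons n).

HB.instance Definition _ := Measure.copy lebesgue_rV_step
  (measure_function_pushforward__canonical__measure_function_Measure _ (@measurable_rV_cons n)).

Lemma sigma_finite_lebesgue_rV_step : sigma_finite setT lebesgue_rV_step.
Proof.
have /sigma_finiteP[F [TF ndF Foo]] := sigma_finiteT (@lebesgue_measure R).
have /sigma_finiteP[G [TG ndG Goo]] := sigma_finiteT m.
exists (fun i => @rV_uncons n @^-1` (F i `*` G i)).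
  rewrite -preimage_bigcup (_ : \bigcup_i _ = setT) ?preimage_setT//.
  rewrite -setXTT TF TG predeqE => -[x y]; split => [[i _ []//]|].
    by move=> Fix Giy; split; exists i.
  move=> [/= [i _ Fix] [j _ Gjy]]; exists (maxn i j) => //; split.
    by move: x Fix; exact/subsetPset/ndF/leq_maxl.
  by move: y Gjy; exact/subsetPset/ndG/leq_maxr.
move=> i; have [mFi Fioo] := Foo i; have [mGi Gioo] := Goo i; split.
  rewrite -[X in measurable X]setTI; apply: measurable_rV_uncons => //.
  exact: measurableX.
rewrite /lebesgue_rV_step /pushforward -comp_preimage.
rewrite (_ : _ \o _ = id) ?preimage_id; last exact/funext/rV_consK.
by rewrite product_measure1E// lte_mul_pinfty// ge0_fin_numE.
Qed.

HB.instance Definition _ := Measure_isSigmaFinite.Build _ _ _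
  lebesgue_rV_step sigma_finite_lebesgue_rV_step.

End step.

(* Lebesgue measure on R^n, as the n-fold product of the one-dimensional
   one; on R^0 it is the unit mass at the only point. *)
Fixpoint lebesgue_rV n : {sigma_finite_measure set 'rV[R]_n -> \bar R} :=
  match n with
  | 0 => \d_ (0 : 'rV[R]_0)
  | n'.+1 => lebesgue_rV_step (lebesgue_rV n')
  end.

Lemma lebesgue_rV_box n (A : 'I_n -> set (measurableTypeR R)) :
  (forall i, measurable (A i)) ->
  (lebesgue_rV n [set x | forall i, A i (rV_coord i x)] =
   \prod_i lebesgue_measure (A i))%E.
Proof.
elim: n A => [|n IH] A mA.
  by rewrite big_ord0 /= diracE mem_set //= => -[].
rewrite big_ord_recl -IH; last by move=> i.
rewrite -product_measure1E; [|exact: mA|].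
  rewrite /= /lebesgue_rV_step /pushforward; congr product_measure1.
  apply/seteqP; split; case=> a x /=.
    move=> H; split; first by have := H ord0; rewrite /rV_coord mxE unlift_none.
    by move=> i; have := H (lift ord0 i); rewrite /rV_coord mxE liftK.
  case=> Ha Hx i; rewrite /rV_coord mxE; case: (unliftP ord0 i) => [j ij|ij]; rewrite ij //.
rewrite (_ : mkset _ = \bigcap_(i in setT) (rV_coord i @^-1` A (lift ord0 i))); last first.
  by apply/seteqP; split => x /= H i; [move=> _|]; apply: H.
apply: fin_bigcap_measurable => // i _.
by rewrite -[X in measurable X]setTI; apply: measurable_rV_coord.
Qed.

End lebesgue_rV.
Arguments lebesgue_rV {R} n.

Section L2.
Variables (R : realType) (d : nat) (Omega : set 'rV[R]_d).
Local Notation mu := (@lebesgue_rV R d).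

(* Functions on Omega are represented by functions on R^d, of which only the
   values on Omega matter; f \_ Omega is the extension by 0 of f. *)
Definition L2 : set ('rV[R]_d -> R) :=
  [set f | f \_ Omega \in Lfun mu 2%:E].

Definition L2norm (f : 'rV[R]_d -> R) : R :=
  fine ('N[mu]_2%:E [EFin \o f \_ Omega])%E.

Definition L2norm_tuple k (u : 'I_k -> 'rV[R]_d -> R) : R :=
  Num.sqrt (\sum_l L2norm (u l) ^+ 2).

(* f represents the almost-everywhere class on Omega of the function g. *)
Definition ae_class_of (g f : 'rV[R]_d -> R) : Prop :=
  measurable_fun Omega f /\ (f = g %[ae mu in Omega]).

Definition unit_spheres k : set ('I_k -> 'rV[R]_d -> R) :=
  [set u | forall l, L2 (u l) /\ L2norm (u l) = 1].

End L2.

Section heat.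
Variables (R : realType) (d : nat).
Local Notation mu := (@lebesgue_rV R d).

(* The norm of 'rV[R]_d is the sup norm, hence the explicit Euclidean one. *)
Definition heat_kernel (t : R) (x : 'rV[R]_d) : R :=
  (4 * pi * t) `^ (- (d%:R / 2)) *
  expR (- (\sum_i x ord0 i ^+ 2) / (4 * t)).

Definition heat (t : R) (v : 'rV[R]_d -> R) (x : 'rV[R]_d) : R :=
  \int[mu]_y (heat_kernel t (x - y) * v y).

(* e^{(tau/2) Delta} v for v defined on Omega. *)
Definition heat_half (Omega : set 'rV[R]_d) (tau : R) (v : 'rV[R]_d -> R) :=
  heat (tau / 2) (v \_ Omega).

End heat.

Section algorithms.
Variables (R : realType) (d k : nat) (Omega : set 'rV[R]_d) (tau : R).
Local Notation mu := (@lebesgue_rV R d).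
Local Notation T := (heat_half Omega tau).
Local Notation fields := ('I_k -> 'rV[R]_d -> R).
Implicit Types (phi u v : fields).

Definition energy phi u : R :=
  k%:R / tau -
  \sum_l tau^-1 * \int[mu]_(x in Omega) (phi l x * `|T (u l) x| ^+ 2).

Definition argmax (a : 'I_k -> R) : {set 'I_k} :=
  [set i | [forall j, a j <= a i]].

Definition is_min_of (A : {set 'I_k}) (l : 'I_k) : bool :=
  (l \in A) && [forall j in A, (l <= j)%N].

Definition partition_of u : fields := fun l x =>
  if is_min_of (argmax (fun i => `|T (u i) x| ^+ 2)) l then 1 else 0.

Definition power_numerator phi v : fields := fun l => T (phi l \* T (v l)).

Definition power_defined phi v : Prop :=
  forall l, L2norm Omega (power_numerator phi v l) != 0.

Definition power_step phi v : fields := fun l x =>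
  power_numerator phi v l x / L2norm Omega (power_numerator phi v l).

(* Equality of fields is equality of their classes on Omega. *)
Definition is_partition phi u : Prop :=
  forall l, ae_class_of Omega (partition_of u l) (phi l).

Definition is_power_step phi v v' : Prop :=
  power_defined phi v /\
  forall l, ae_class_of Omega (power_step phi v l) (v' l).

Definition algorithm1 (phi u : nat -> fields) : Prop :=
  unit_spheres Omega (u 0) /\
  forall s, is_partition (phi s) (u s) /\
            is_power_step (phi s) (u s) (u s.+1).

(* One outer iteration, from u to u': w starts from u, and the
   first increment smaller than tol is the one from w M to w M.+1. *)
Definition inner_loop (tol : R) phi u u' : Prop :=
  exists (w : nat -> fields) (M : nat),
    [/\ w 0 = u,
        forall m, (m <= M)%N -> is_power_step phi (w m) (w m.+1),
        forall m, (m < M)%N ->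
          tol <= L2norm_tuple Omega (fun l => w m.+1 l \- w m l),
        L2norm_tuple Omega (fun l => w M.+1 l \- w M l) < tol &
        u' = w M.+1].

Definition algorithm2 (tol : R) (phi u : nat -> fields) : Prop :=
  unit_spheres Omega (u 0) /\
  forall s, is_partition (phi s) (u s) /\
            inner_loop tol (phi s) (u s) (u s.+1).

End algorithms.

(* Main.v *)
Require Import Defs.
From mathcomp Require Import all_boot all_order all_algebra.
From mathcomp Require Import all_classical all_reals all_analysis.
From mathcomp Require Import ring lra measurable_realfun.

(* Let T be the heat operator on L^2(Omega), A = T (phi_l T) and
   B(f, g) = <f, A g> = \int phi_l Tf Tg. T is self-adjoint (Fubini, the kernel
   being bounded and symmetric and Omega having finite measure), so B is
   symmetric and positive semidefinite. For a power step u' = A u / |A u| with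
   |u| = 1, Cauchy-Schwarz for B gives
     |A u|^2 = B(u, u')^2 <= B(u, u) B(u', u'),
   while B(u, u) = |A u| <u, u'> <= |A u|; hence B(u, u) <= B(u', u'), i.e. the
   energy at fixed phi does not increase. Replacing phi^s by phi^(s+1) selects the
   pointwise largest |T u^(s+1)_l|^2, which can only decrease the energy further. *)

Set Implicit Arguments.
Unset Strict Implicit.
Unset Printing Implicit Defensive.

Import Order.TTheory GRing.Theory Num.Theory.
Import numFieldNormedType.Exports.

Local Open Scope classical_set_scope.
Local Open Scope ring_scope.

(** Evaluating the form at (s, t) = (-b, a) gives a (ac - b^2) >= 0, which settles a > 0. If a = 0,
    a nonzero b would make the form equal to -1 at s = -(c + 1)/(2b), t = 1. *)
Lemma discriminant_le (R : realFieldType) (a b c : R) :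
  (forall s t, 0 <= s ^+ 2 * a + s * t * b *+ 2 + t ^+ 2 * c) ->
  b ^+ 2 <= a * c.
Proof.
move=> H; have a0 : 0 <= a by have := H 1 0; lra.
have [a_eq0|an0] := eqVneq a 0; last first.
  have Hab := H (- b) a.
  have : 0 <= a * (a * c - b ^+ 2) by lra.
  by rewrite pmulr_rge0 ?lt0r ?an0// subr_ge0.
have [->|bn0] := eqVneq b 0; first by rewrite a_eq0 expr0n/= mul0r.
have := H (- ((c + 1) / (b *+ 2))) 1.
suff -> : (- ((c + 1) / (b *+ 2))) * 1 * b *+ 2 = - (c + 1).
  by rewrite a_eq0; lra.
by field; rewrite bn0.
Qed.

(** * Real-valued integrals modulo null sets, and weighted Cauchy-Schwarz *)

Section Rintegral_ae.
Context d (T : measurableType d) (R : realType).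
Context (mu : {measure set T -> \bar R}) (D : set T) (mD : measurable D).
Implicit Types f g w : T -> R.

Lemma ae_integrable f g : mu.-integrable D (EFin \o f) ->
  measurable_fun D g -> f = g %[ae mu in D] -> mu.-integrable D (EFin \o g).
Proof.
move=> /integrableP[mf fi] mg fg; apply/integrableP; split.
  exact/measurable_EFinP.
apply: le_lt_trans fi; apply: ae_ge0_le_integral => //.
- by apply: measurableT_comp => //; exact/measurable_EFinP.
- exact: measurableT_comp.
- by apply: filterS fg => x + Dx => /(_ Dx) /= ->.
Qed.

Lemma ae_eq_Rintegral f g : measurable_fun D f -> measurable_fun D g ->
  f = g %[ae mu in D] -> \int[mu]_(x in D) f x = \int[mu]_(x in D) g x.
Proof.
move=> mf mg fg; congr fine; apply: ae_eq_integral => //.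
- exact/measurable_EFinP.
- exact/measurable_EFinP.
- by apply: filterS fg => x + Dx => /(_ Dx) /= ->.
Qed.

(** [f \max g] dominates [f] everywhere and equals [g] almost everywhere, which reduces the claim to
    monotonicity under a pointwise inequality. *)
Lemma ae_le_Rintegral f g :
  mu.-integrable D (EFin \o f) -> mu.-integrable D (EFin \o g) ->
  (\forall x \ae mu, D x -> f x <= g x) ->
  \int[mu]_(x in D) f x <= \int[mu]_(x in D) g x.
Proof.
move=> fi gi fg.
have mf : measurable_fun D f by exact/measurable_EFinP/(measurable_int mu).
have mg : measurable_fun D g by exact/measurable_EFinP/(measurable_int mu).
have mM : measurable_fun D (f \max g) by exact: measurable_maxr.
have gM : g = (f \max g) %[ae mu in D].
  by apply: filterS fg => x + Dx => /(_ Dx) /= /max_r ->.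
rewrite (ae_eq_Rintegral mg mM gM); apply: le_Rintegral => //.
- exact: ae_integrable gi mM gM.
- by move=> x _; rewrite /= le_max lexx.
Qed.

Lemma ae_bounded_integrable f (M : R) : (mu D < +oo)%E -> measurable_fun D f ->
  (\forall x \ae mu, D x -> `|f x| <= M) -> mu.-integrable D (EFin \o f).
Proof.
move=> Doo mf fM; apply/integrableP; split; first exact/measurable_EFinP.
(* The absolute value is taken because [M] may be negative when [D] is a null set. *)
apply: (@le_lt_trans _ _ (\int[mu]_(x in D) (`|M|%:E))%E).
  apply: ae_ge0_le_integral => //.
  - by apply: measurableT_comp => //; exact/measurable_EFinP.
  - apply: filterS fM => x + Dx => /(_ Dx) /= fxM.
    by rewrite lee_fin (le_trans fxM)// ler_norm.
by rewrite integral_cst// lte_mul_pinfty.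
Qed.

Lemma integrableD_EFin f g :
  mu.-integrable D (EFin \o f) -> mu.-integrable D (EFin \o g) ->
  mu.-integrable D (EFin \o (fun x => f x + g x)).
Proof. by move=> fi gi; exact: (integrableD mD fi gi). Qed.

Lemma integrableZl_EFin (r : R) f : mu.-integrable D (EFin \o f) ->
  mu.-integrable D (EFin \o (fun x => r * f x)).
Proof. by move=> fi; exact: (integrableZl mD r fi). Qed.

Lemma integrable_sum_EFin (I : Type) (s : seq I) (f : I -> T -> R) :
  (forall i, mu.-integrable D (EFin \o f i)) ->
  mu.-integrable D (EFin \o (fun x => \sum_(i <- s) f i x)).
Proof.
move=> fi.
have := integrable_sum mD s (P := xpredT) (fun i _ => fi i).
apply: eq_integrable => //.
by move=> x _ /=; rewrite sumEFin.
Qed.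

Lemma Rintegral_sum (I : Type) (s : seq I) (f : I -> T -> R) :
  (forall i, mu.-integrable D (EFin \o f i)) ->
  \int[mu]_(x in D) (\sum_(i <- s) f i x) =
  \sum_(i <- s) \int[mu]_(x in D) f i x.
Proof.
move=> fi; rewrite /Rintegral sum_fine; last first.
  by move=> i _; exact: (integrable_fin_num mD (fi i)).
rewrite -(integral_sum mD fi); congr fine.
by apply: eq_integral => x _; rewrite sumEFin.
Qed.

(** |f| <= 1 + f^2, and constants are integrable on a set of finite measure. *)
Lemma integrable_of_sqr f : (mu D < +oo)%E -> measurable_fun D f ->
  mu.-integrable D (EFin \o (fun x => f x ^+ 2)) ->
  mu.-integrable D (EFin \o f).
Proof.
move=> Doo mf f2i.
have f21 : mu.-integrable D (EFin \o (fun x => 1 + f x ^+ 2)).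
  apply: integrableD_EFin => //.
  apply: (@ae_bounded_integrable (cst 1) 1) => //.
  by apply: aeW => x _; rewrite normr1.
apply: (le_integrable mD _ _ f21); first exact/measurable_EFinP.
move=> x _ /=; rewrite lee_fin [leRHS]ger0_norm; last first.
  by rewrite addr_ge0// sqr_ge0.
by rewrite ler_norml; apply/andP; split; nra.
Qed.

(** |f g| <= f^2 + g^2. *)
Lemma integrable_mul_of_sqr f g :
  measurable_fun D f -> measurable_fun D g ->
  mu.-integrable D (EFin \o (fun x => f x ^+ 2)) ->
  mu.-integrable D (EFin \o (fun x => g x ^+ 2)) ->
  mu.-integrable D (EFin \o (fun x => f x * g x)).
Proof.
move=> mf mg f2i g2i.
have fg2 := integrableD_EFin f2i g2i.
apply: (le_integrable mD _ _ fg2).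
  by apply/measurable_EFinP; exact: measurable_funM.
move=> x _ /=; rewrite lee_fin [leRHS]ger0_norm; last first.
  by rewrite addr_ge0// sqr_ge0.
by rewrite ler_norml; apply/andP; split; nra.
Qed.

(** The discriminant inequality for the nonnegative quadratic form sending (s, t) to the integral of
    w (s f + t g)^2. The sign of [w] is required only almost everywhere, since phi_l will be known
    only as a class. *)
Lemma Rintegral_cauchy_schwarz w f g :
  (\forall x \ae mu, D x -> 0 <= w x) ->
  mu.-integrable D (EFin \o (fun x => w x * f x ^+ 2)) ->
  mu.-integrable D (EFin \o (fun x => w x * (f x * g x))) ->
  mu.-integrable D (EFin \o (fun x => w x * g x ^+ 2)) ->
  (\int[mu]_(x in D) (w x * (f x * g x))) ^+ 2 <=
  \int[mu]_(x in D) (w x * f x ^+ 2) * \int[mu]_(x in D) (w x * g x ^+ 2).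
Proof.
move=> w0 ffi fgi ggi; apply: discriminant_le => s t.
rewrite -mulrnAl -!RintegralZl// -!RintegralD//; try exact: integrableZl_EFin; last first.
  by apply: integrableD_EFin; exact: integrableZl_EFin.
rewrite -(_ : \int[mu]_(x in D) 0 = 0); last by rewrite Rintegral_cst// mul0r.
apply: ae_le_Rintegral.
- exact: integrable0.
- by apply: integrableD_EFin; [apply: integrableD_EFin|]; exact: integrableZl_EFin.
- apply: filterS w0 => x + Dx => /(_ Dx) wx.
  suff -> : s ^+ 2 * (w x * f x ^+ 2) + s * t *+ 2 * (w x * (f x * g x)) +
    t ^+ 2 * (w x * g x ^+ 2) = w x * (s * f x + t * g x) ^+ 2.
    by rewrite mulr_ge0// sqr_ge0.
  by ring.
Qed.

End Rintegral_ae.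

(** * Integral operators with bounded symmetric kernel on a set of finite measure *)

Section kernel_operator.
Context d (T : measurableType d) (R : realType).
Context (mu : {sigma_finite_measure set T -> \bar R}).
Context (D : set T) (mD : measurable D) (Doo : (mu D < +oo)%E).
Context (K : T -> T -> R) (C : R).
Hypothesis mK : measurable_fun setT (fun p : T * T => K p.1 p.2).
Hypothesis K_le : forall x y, `|K x y| <= C.
Hypothesis K_sym : forall x y, K x y = K y x.
Implicit Types u v w : T -> R.

(** Integrating the extension by zero over the whole space makes this operator convertible to
    [heat_half] when [K x y] is [heat_kernel (tau / 2) (x - y)]. *)
Definition kernel_op v (x : T) : R := \int[mu]_y (K x y * (v \_ D) y).

Let measurable_section x : measurable_fun setT (K x).
Proof. exact: (measurableT_comp mK (measurable_pair1 x)). Qed.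

Let measurable_zero_extension v : mu.-integrable D (EFin \o v) ->
  mu.-integrable setT (EFin \o (v \_ D)).
Proof. by move/(integrable_mkcond _ mD); rewrite restrict_EFin. Qed.

Lemma kernel_opE v x :
  kernel_op v x = \int[mu]_(y in D) (K x y * v y).
Proof.
rewrite /kernel_op [RHS]Rintegral_mkcond; apply: eq_Rintegral => y _.
by rewrite !patchE; case: ifPn => // _; rewrite mulr0.
Qed.

Lemma integrable_kernelM v x : mu.-integrable D (EFin \o v) ->
  mu.-integrable D (EFin \o (fun y => K x y * v y)).
Proof.
move=> vi; have mv : measurable_fun D v by exact/measurable_EFinP/(measurable_int mu).
have := integrableZl_EFin mD C (integrable_norm vi).
apply: le_integrable => //.
  apply/measurable_EFinP; apply: measurable_funM => //.
  exact: measurable_funTS.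
move=> y _ /=; rewrite lee_fin !normrM normr_id ler_wpM2r//.
by rewrite (le_trans (K_le x y))// ler_norm.
Qed.

Lemma kernel_op_bounded v : mu.-integrable D (EFin \o v) ->
  forall x, `|kernel_op v x| <= C * \int[mu]_(y in D) `|v y|.
Proof.
move=> vi x; rewrite kernel_opE.
apply: le_trans (le_normr_Rintegral mD (integrable_kernelM x vi)) _.
rewrite -RintegralZl//; last exact: integrable_norm.
apply: le_Rintegral => //.
- exact: integrable_norm (integrable_kernelM x vi).
- exact: integrableZl_EFin (integrable_norm vi).
- by move=> y _; rewrite normrM ler_wpM2r.
Qed.

(** By Tonelli, the integral of the absolute value is at most [C] times the product of the L^1(D)
    norms of [u] and [v]. This justifies the later use of Fubini. *)
Let product_integrable u v :
  mu.-integrable D (EFin \o u) -> mu.-integrable D (EFin \o v) ->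
  ((mu \x mu)%E).-integrable setT
    (fun p : T * T => ((u \_ D) p.1 * (K p.1 p.2 * (v \_ D) p.2))%:E).
Proof.
move=> /measurable_zero_extension ui /measurable_zero_extension vi.
have mU : measurable_fun setT (u \_ D).
  exact/measurable_EFinP/(measurable_int mu).
have mV : measurable_fun setT (v \_ D).
  exact/measurable_EFinP/(measurable_int mu).
apply/integrable12ltyP.
  apply/measurable_EFinP; apply: measurable_funM.
    exact: (measurableT_comp mU measurable_fst).
  apply: measurable_funM => //.
  exact: (measurableT_comp mV measurable_snd).
have uni := integrable_norm ui.
have vni := integrable_norm vi.
pose cv := (\int[mu]_y `|(v \_ D) y|%:E)%E.
have cv_fin : cv \is a fin_num by exact: (integrable_fin_num measurableT vni).
apply: (@le_lt_trans _ _ (\int[mu]_x (`|(u \_ D) x|%:E * (C%:E * cv)))%E).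
  apply: ge0_le_integral => //.
  - by move=> x _; apply: integral_ge0.
  - apply: (measurable_fun_fubini_tonelli_F
      (fun p : T * T => `|((u \_ D) p.1 * (K p.1 p.2 * (v \_ D) p.2))%:E|%E)) => //.
    apply: measurableT_comp => //; apply/measurable_EFinP.
    apply: measurable_funM; first exact: (measurableT_comp mU measurable_fst).
    apply: measurable_funM => //; exact: (measurableT_comp mV measurable_snd).
  - apply: emeasurable_funM => //.
    by apply/measurable_EFinP; exact: measurableT_comp.
  - move=> x _ /=; rewrite muleA -EFinM -ge0_integralZl//; last 2 first.
    + by apply/measurable_EFinP; exact: measurableT_comp.
    + by rewrite lee_fin mulr_ge0// (le_trans _ (K_le x x)).
    apply: ge0_le_integral => //.
    + apply/measurable_EFinP; apply: measurableT_comp => //.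
      apply: (measurable_funM (f := cst _)) => //.
      exact: (measurable_funM (measurable_section x) mV).
    + apply: measurable_funeM.
      by apply/measurable_EFinP; exact: measurableT_comp.
    + move=> y _; rewrite -EFinM lee_fin !normrM mulrA ler_wpM2r//.
      by rewrite ler_wpM2l.
rewrite -(fineK cv_fin) -EFinM.
by have /(integrable_lty measurableT) := integrableZr measurableT (C * fine cv) uni.
Qed.

(** On [D] the operator is the partial integral in y of 1_D(x) K(x, y) 1_D(y) v(y), measurable by
    Fubini; [product_integrable] applies because the constant 1 is integrable on [D]. *)
Lemma measurable_kernel_op v : mu.-integrable D (EFin \o v) ->
  measurable_fun D (kernel_op v).
Proof.
move=> vi.
have oi : mu.-integrable D (EFin \o cst 1).
  apply: (ae_bounded_integrable mD (M := 1)) => //.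
  by apply: aeW => x _ /=; rewrite normr1.
have mF := measurable_fubini_F (product_integrable oi vi).
have mfF := measurable_funTS (D := D)
  (measurableT_comp (@fine_measurable R setT measurableT) mF).
apply: eq_measurable_fun mfF => x xD.
rewrite /fubini_F /= /kernel_op; congr fine.
by apply: eq_integral => y _; rewrite !patchE xD mul1r.
Qed.

(** Both sides are iterated integrals of u(x) K(x, y) v(y) over D x D, in opposite orders once the
    symmetry of [K] is used. *)
Lemma kernel_op_selfadjoint u v :
  mu.-integrable D (EFin \o u) -> mu.-integrable D (EFin \o v) ->
  \int[mu]_(x in D) (u x * kernel_op v x) =
  \int[mu]_(x in D) (kernel_op u x * v x).
Proof.
move=> ui vi.
have vDi := measurable_zero_extension vi.
have uDi := measurable_zero_extension ui.
have KM w x : mu.-integrable setT (EFin \o (w \_ D)) ->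
    mu.-integrable setT (EFin \o (fun y => K x y * (w \_ D) y)).
  move=> wi; rewrite (_ : (fun y => _) = (fun y => K x y * w y) \_ D).
    rewrite -restrict_EFin; apply/(integrable_mkcond _ mD)/integrable_kernelM.
    by apply/(integrable_mkcond _ mD); rewrite restrict_EFin.
  by apply/funext => y; rewrite !patchE; case: ifPn => // _; rewrite mulr0.
rewrite Rintegral_mkcond [RHS]Rintegral_mkcond.
transitivity (fine (\int[mu]_x \int[mu]_y
    ((u \_ D) x * (K x y * (v \_ D) y))%:E)%E).
  congr fine; apply: eq_integral => x _; rewrite -[RHS]fineK.
    rewrite -[fine _]/(\int[mu]_y _) RintegralZl//; last exact: KM.
    by rewrite !patchE; case: ifPn => // _; rewrite mul0r.
  apply: integrable_fin_num => //.
  exact: integrableZl_EFin (KM v x vDi).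
rewrite (Fubini (product_integrable ui vi)).
congr fine; apply: eq_integral => y _; rewrite -[LHS]fineK.
  rewrite -[fine _]/(\int[mu]_x _).
  rewrite (@eq_Rintegral _ _ _ _ _
    (fun x => (v \_ D) y * (K y x * (u \_ D) x))); last first.
    by move=> x _; rewrite (K_sym x y); ring.
  rewrite RintegralZl//; last exact: KM.
  by rewrite !patchE mulrC; case: ifPn => // _; rewrite mulr0.
apply: integrable_fin_num => //.
apply: eq_integrable (integrableZl_EFin measurableT ((v \_ D) y) (KM u y uDi)) => //.
by move=> x _ /=; rewrite K_sym; congr EFin; ring.
Qed.

Definition unit_L2 u : Prop :=
  [/\ measurable_fun D u, mu.-integrable D (EFin \o (fun x => u x ^+ 2)) &
      \int[mu]_(x in D) u x ^+ 2 = 1].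

(** * Monotonicity of one normalized power step *)

Section power_step.
Context (w : T -> R) (mw : measurable_fun D w).
Hypothesis w_ge0 : \forall x \ae mu, D x -> 0 <= w x.
Hypothesis w_le1 : \forall x \ae mu, D x -> w x <= 1.

(** [kernel_op u] is bounded by [C] times the L^1 norm of [u], and [w] lies in [0, 1] almost
    everywhere; bounded functions are integrable on [D]. The same bound on [kernel_op u] yields the
    next two lemmas. *)
Lemma integrable_weight_kernel_op u : mu.-integrable D (EFin \o u) ->
  mu.-integrable D (EFin \o (fun x => w x * kernel_op u x)).
Proof.
move=> ui; apply: (ae_bounded_integrable mD
  (M := C * \int[mu]_(y in D) `|u y|)) => //.
  by apply: measurable_funM => //; exact: measurable_kernel_op.
apply: filterS2 w_ge0 w_le1 => x + + Dx => /(_ Dx) w0 /(_ Dx) w1.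
rewrite normrM (ger0_norm w0) (le_trans _ (kernel_op_bounded ui x))//.
by rewrite ler_piMl.
Qed.

Lemma integrable_weight_kernel_opM u v :
  mu.-integrable D (EFin \o u) -> mu.-integrable D (EFin \o v) ->
  mu.-integrable D (EFin \o (fun x => w x * (kernel_op u x * kernel_op v x))).
Proof.
move=> ui vi.
have [mTu mTv] := (measurable_kernel_op ui, measurable_kernel_op vi).
apply: (ae_bounded_integrable mD
  (M := (C * \int[mu]_(y in D) `|u y|) * (C * \int[mu]_(y in D) `|v y|))) => //.
  by apply: measurable_funM => //; exact: measurable_funM.
apply: filterS2 w_ge0 w_le1 => x + + Dx => /(_ Dx) w0 /(_ Dx) w1.
rewrite !normrM (ger0_norm w0).
rewrite (le_trans (ler_piMl _ w1)) ?mulr_ge0//.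
by rewrite ler_pM// kernel_op_bounded.
Qed.

Lemma integrable_kernel_op_sqr u : mu.-integrable D (EFin \o u) ->
  mu.-integrable D (EFin \o (fun x => kernel_op u x ^+ 2)).
Proof.
move=> ui; apply: (ae_bounded_integrable mD
  (M := (C * \int[mu]_(y in D) `|u y|) ^+ 2)) => //.
  by apply: measurable_funX; exact: measurable_kernel_op.
apply: aeW => x _; rewrite normrX ler_sqr ?nnegrE ?kernel_op_bounded//.
exact: le_trans (kernel_op_bounded ui x).
Qed.

(** In the notation of the overview, [w] is phi_l, [A] is the function A u and [N] its norm. That
    [u'] is again a unit vector belongs to the conclusion so that steps can be chained. *)
Lemma power_step_monotone u u' (A := kernel_op (fun x => w x * kernel_op u x))
    (N := Num.sqrt (\int[mu]_(x in D) A x ^+ 2)) :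
  unit_L2 u -> N != 0 -> measurable_fun D u' ->
  u' = (fun x => A x / N) %[ae mu in D] ->
  unit_L2 u' /\
  \int[mu]_(x in D) (w x * kernel_op u x ^+ 2) <=
  \int[mu]_(x in D) (w x * kernel_op u' x ^+ 2).
Proof.
move=> [mes_u u2i u21] N0 mes_u' Au'.
have ui := integrable_of_sqr mD Doo mes_u u2i.
have gi := integrable_weight_kernel_op ui.
have mA : measurable_fun D A by exact: measurable_kernel_op.
have A2i : mu.-integrable D (EFin \o (fun x => A x ^+ 2)).
  exact: integrable_kernel_op_sqr.
have N_ge0 : 0 <= N by exact: sqrtr_ge0.
have N_gt0 : 0 < N by rewrite lt0r N0.
have NE : N ^+ 2 = \int[mu]_(x in D) A x ^+ 2.
  by rewrite sqr_sqrtr//; apply: Rintegral_ge0 => x _; exact: sqr_ge0.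
(* The normalization is used in the form A = N u', along which the integrals below are
   transferred. *)
have AE : A = (fun x => N * u' x) %[ae mu in D].
  by apply: filterS Au' => x + Dx => /(_ Dx) ->; rewrite mulrC divfK.
have mNu' : measurable_fun D (fun x => N * u' x).
  exact: measurable_funM.
have NN2 x : N^-1 ^+ 2 * (N * u' x) ^+ 2 = u' x ^+ 2.
  by rewrite -exprMn mulrA mulVf// mul1r.
have Nu'2i : mu.-integrable D (EFin \o (fun x => (N * u' x) ^+ 2)).
  apply: (ae_integrable mD A2i); first exact: measurable_funX.
  by apply: filterS AE => x + Dx => /(_ Dx) ->.
have u'2i : mu.-integrable D (EFin \o (fun x => u' x ^+ 2)).
  apply: eq_integrable (integrableZl_EFin mD (N^-1 ^+ 2) Nu'2i) => //.
  by move=> x _ /=; rewrite NN2.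
have u'21 : \int[mu]_(x in D) u' x ^+ 2 = 1.
  under eq_Rintegral do rewrite -NN2.
  rewrite RintegralZl//.
  rewrite -(ae_eq_Rintegral mD (f := fun x => A x ^+ 2)); last 3 first.
  - exact: measurable_funX.
  - exact: measurable_funX.
  - by apply: filterS AE => x + Dx => /(_ Dx) ->.
  by rewrite -NE -exprMn mulVf// expr1n.
have u'i := integrable_of_sqr mD Doo mes_u' u'2i.
have uu'i := integrable_mul_of_sqr mD mes_u mes_u' u2i u'2i.
split; first by split.
(* B(u, u) = <u, A u> = N <u, u'>. *)
have Buu : \int[mu]_(x in D) (w x * kernel_op u x ^+ 2) =
    N * \int[mu]_(x in D) (u x * u' x).
  transitivity (\int[mu]_(x in D) (u x * A x)).
    rewrite kernel_op_selfadjoint//.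
    by apply: eq_Rintegral => x _; ring.
  rewrite -RintegralZl//; apply: ae_eq_Rintegral => //.
  - exact: measurable_funM.
  - by apply: measurable_funM => //; exact: measurable_funM.
  - by apply: filterS AE => x + Dx => /(_ Dx) ->; rewrite mulrCA.
(* B(u, u') = <A u, u'> = N |u'|^2 = N. *)
have Buu' : \int[mu]_(x in D) (w x * (kernel_op u x * kernel_op u' x)) = N.
  transitivity (\int[mu]_(x in D) (A x * u' x)).
    rewrite -kernel_op_selfadjoint//.
    by apply: eq_Rintegral => x _; rewrite mulrA.
  rewrite (ae_eq_Rintegral mD (g := fun x => N * u' x ^+ 2)).
  - by rewrite RintegralZl// u'21 mulr1.
  - exact: measurable_funM.
  - by apply: measurable_funM => //; exact: measurable_funX.
  - by apply: filterS AE => x + Dx => /(_ Dx) ->; rewrite expr2 mulrA.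
(* Cauchy-Schwarz in L^2 is the case of weight 1; [I1] and [R1] insert and remove the factor
   [cst 1]. *)
have CSu : (\int[mu]_(x in D) (u x * u' x)) ^+ 2 <= 1.
  have I1 h : mu.-integrable D (EFin \o h) ->
      mu.-integrable D (EFin \o (fun x => cst 1 x * h x)).
    exact: integrableZl_EFin.
  have R1 h : \int[mu]_(x in D) (cst 1 x * h x) = \int[mu]_(x in D) h x.
    by apply: eq_Rintegral => x _; rewrite mul1r.
  have := @Rintegral_cauchy_schwarz _ _ _ mu D mD (cst 1) u u' _
    (I1 _ u2i) (I1 _ uu'i) (I1 _ u'2i).
  by rewrite !R1 u21 u'21 mulr1; apply; apply: aeW => x _ /=.
have CSB : N ^+ 2 <= \int[mu]_(x in D) (w x * kernel_op u x ^+ 2) *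
    \int[mu]_(x in D) (w x * kernel_op u' x ^+ 2).
  rewrite -[in leLHS]Buu'; apply: Rintegral_cauchy_schwarz => //;
    exact: integrable_weight_kernel_opM.
have B_ge0 : 0 <= \int[mu]_(x in D) (w x * kernel_op u x ^+ 2).
  rewrite -(_ : \int[mu]_(x in D) 0 = 0); last by rewrite Rintegral_cst// mul0r.
  apply: ae_le_Rintegral => //; first exact: integrable0.
    exact: integrable_weight_kernel_opM.
  by apply: filterS w_ge0 => x + Dx => /(_ Dx) ?; rewrite mulr_ge0// sqr_ge0.
(* If B(u, u) vanished, Cauchy-Schwarz for B would force N^2 <= 0. *)
have B_gt0 : 0 < \int[mu]_(x in D) (w x * kernel_op u x ^+ 2).
  rewrite lt0r B_ge0 andbT; apply: contraTneq CSB => ->.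
  by rewrite mul0r -ltNge exprn_gt0.
(* B(u, u)^2 = N^2 <u, u'>^2 <= N^2 <= B(u, u) B(u', u'), and B(u, u) cancels. *)
rewrite -(ler_pM2l B_gt0) (le_trans _ CSB)// -expr2 Buu exprMn.
by rewrite ler_piMr// sqr_ge0.
Qed.

End power_step.

End kernel_operator.

(** * Measurability of open sets and finite measure of bounded sets in R^n *)

Section lebesgue_rV_sets.
Context (R : realType) (n : nat).

Lemma measurable_rV_box (A : 'I_n -> set (measurableTypeR R)) :
  (forall i, measurable (A i)) ->
  measurable [set x : 'rV[R]_n | forall i, A i (rV_coord i x)].
Proof.
move=> mA.
rewrite (_ : mkset _ = \bigcap_(i in setT) (rV_coord i @^-1` A i)); last first.
  by apply/seteqP; split => x /= H i; [move=> _|]; apply: H.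
apply: fin_bigcap_measurable => // i _.
by rewrite -[X in measurable X]setTI; apply: measurable_rV_coord.
Qed.

(** The sigma-algebra is generated by the coordinates, so [A] is written as the countable union of
    the boxes with rational centre and half-side 1/(m + 1) that it contains. *)
Lemma measurable_open_rV (A : set 'rV[R]_n) : open A -> measurable A.
Proof.
move=> oA.
pose box (p : 'rV[rat]_n * nat) : set 'rV[R]_n :=
  [set x | forall i, ball (ratr (p.1 ord0 i) : R) p.2.+1%:R^-1 (rV_coord i x)].
pose F p := if `[< box p `<=` A >] then box p else set0.
suff -> : A = \bigcup_p F p.
  apply: countable_bigcupT_measurable => // p; rewrite /F; case: ifPn => // _.
  apply: (@measurable_rV_box
    (fun i => ball (ratr (p.1 ord0 i) : R) p.2.+1%:R^-1)) => i.
  exact: measurable_ball.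
apply/seteqP; split=> [x Ax|x [p _]]; last first.
  by rewrite /F; case: asboolP => // pA; exact: pA.
have /nbhs_ballP[e e0 xeA] : nbhs x A by exact: open_nbhs_nbhs.
(* Half of [e] suffices: [x] and any point of the chosen box are each within 1/(m + 1) of its
   centre, coordinate by coordinate. *)
have [m me] : exists m : nat, m.+1%:R^-1 < e / 2 :> R.
  have e2 : 0 < e / 2 by rewrite divr_gt0.
  have := near_infty_natSinv_lt (PosNum e2); case=> m _ /(_ m (leqnn m)) /= me.
  by exists m.
have /choice[q qP] : forall i, exists q : rat, ball (ratr q : R) m.+1%:R^-1 (x ord0 i).
  move=> i.
  have xm : x ord0 i - m.+1%:R^-1 < x ord0 i + m.+1%:R^-1.
    by rewrite ltrD2l gtrN// invr_gt0.
  have [q] := rat_in_itvoo xm.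
  rewrite in_itv/= => /andP[ql qr]; exists q.
  by rewrite /ball/= distrC ltr_distlC ql.
exists (\row_i q i, m) => //; rewrite /F asboolT => [|y yq].
  by move=> i /=; rewrite mxE; exact: qP.
apply: xeA; split=> // i j; rewrite (ord1 i).
apply: (@le_ball _ _ _ (m.+1%:R^-1 + m.+1%:R^-1)).
  by rewrite (splitr e); rewrite lerD// ltW.
apply: (ball_triangle (y := ratr (q j) : R)); first exact/ball_sym/qP.
by have := yq j; rewrite /= mxE.
Qed.

(** [A] lies in a cube, whose measure is a finite product of finite lengths. *)
Lemma bounded_rV_measure_lty (A : set 'rV[R]_n) :
  measurable A -> bounded_set A -> (lebesgue_rV n A < +oo)%E.
Proof.
move=> mA [M [_ AM]].
(* The norm on [A] is bounded by every number above [M], and |M| + 1 is such a number. *)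
pose I : set (measurableTypeR R) := `[- (`|M| + 1), `|M| + 1]%classic.
have mI : measurable I by exact: measurable_itv.
apply: (@le_lt_trans _ _ (lebesgue_rV n [set x | forall i, I (rV_coord i x)])).
  apply: le_measure; rewrite ?inE//.
    exact: (@measurable_rV_box (fun=> I)).
  move=> x Ax i; rewrite /I /= in_itv/= -ler_norml /rV_coord.
  have MM : M < `|M| + 1 by rewrite (le_lt_trans (ler_norm M))// ltrDl.
  apply: le_trans (AM _ MM x Ax).
  rewrite [leRHS]mx_normrE.
  exact: (@le_bigmax _ _ _ 0 (fun ij => `|x ij.1 ij.2|) (ord0, i)).
rewrite (@lebesgue_rV_box R n (fun=> I))// ltey_eq.
apply/orP; left; elim/big_ind: _ => // [x y|i _]; first exact: fin_numM.
by rewrite lebesgue_measure_itv/=; case: ifPn.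
Qed.

End lebesgue_rV_sets.

(** * The heat kernel satisfies the hypotheses on [K] *)

Section heat_kernel.
Context (R : realType) (d : nat) (t : R).
Hypothesis t_gt0 : 0 < t.

Lemma measurable_heat_kernel_sub : measurable_fun setT
  (fun p : 'rV[R]_d * 'rV[R]_d => heat_kernel t (p.1 - p.2)).
Proof.
apply: measurable_funM => //; apply: measurableT_comp => //.
apply: measurable_funM => //; apply: measurable_funN.
apply: measurable_sum => i; apply: measurable_funX.
rewrite (_ : (fun p => _) = (fun p => rV_coord i p.1 - rV_coord i p.2)).
  apply: measurable_funB.
    exact: (measurableT_comp (measurable_rV_coord i) measurable_fst).
  exact: (measurableT_comp (measurable_rV_coord i) measurable_snd).
by apply/funext => p; rewrite !mxE.
Qed.

(** The exponential factor is at most 1, so the bound is the value at the origin; it serves as the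
    constant [C]. *)
Lemma normr_heat_kernel_le (x : 'rV[R]_d) :
  `|heat_kernel t x| <= (4 * pi * t) `^ (- (d%:R / 2)).
Proof.
rewrite ger0_norm ?mulr_ge0 ?powR_ge0 ?expR_ge0// ler_piMr ?powR_ge0//.
rewrite -[leRHS]expR0 ler_expR mulNr oppr_le0 divr_ge0//; last first.
  by rewrite mulr_ge0// ltW.
by apply: sumr_ge0 => i _; exact: sqr_ge0.
Qed.

Lemma heat_kernel_subC (x y : 'rV[R]_d) :
  heat_kernel t (x - y) = heat_kernel t (y - x).
Proof.
rewrite /heat_kernel; do 4 f_equal; apply: eq_bigr => i _.
by rewrite !mxE -sqrrN opprB.
Qed.

End heat_kernel.

(** * The L^2 norm in terms of integrals of squares *)

Section L2_lemmas.
Context (R : realType) (d : nat) (Omega : set 'rV[R]_d).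
Hypothesis mOmega : measurable Omega.
Local Notation mu := (@lebesgue_rV R d).

Lemma L2normE (f : 'rV[R]_d -> R) :
  L2norm Omega f = Num.sqrt (\int[mu]_(x in Omega) f x ^+ 2).
Proof.
rewrite /L2norm unlock fine_poweR powR12_sqrt ?fine_ge0 ?integral_ge0//; last first.
  by move=> x _; exact: poweR_ge0.
congr Num.sqrt; rewrite Rintegral_mkcond; congr fine.
apply: eq_integral => x _ /=.
rewrite powR_mulrn// real_normK ?num_real// !patchE.
by case: ifPn => // _; rewrite expr0n.
Qed.

Lemma unit_L2_of_L2 (f : 'rV[R]_d -> R) :
  L2 Omega f -> L2norm Omega f = 1 -> unit_L2 mu Omega f.
Proof.
move=> L2f f1.
have mf : measurable_fun Omega f.
  apply/(measurable_restrictT _ mOmega).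
  by move: L2f; rewrite /L2/= inE => /andP[/[!inE]].
split => //.
  apply/(integrable_mkcond _ mOmega).
  have := Lfun2_integrable_sqr L2f.
  apply: eq_integrable => // x _; rewrite restrict_EFin /= !patchE.
  by case: ifPn => // _; rewrite expr0n.
have f2_ge0 : 0 <= \int[mu]_(x in Omega) f x ^+ 2.
  by apply: Rintegral_ge0 => x _; exact: sqr_ge0.
by rewrite -(sqr_sqrtr f2_ge0) -L2normE f1 expr1n.
Qed.

End L2_lemmas.

(** * Selection of the smallest maximizing index *)

Section argmax_selection.
Context (R : realType) (k : nat).
Hypothesis k_gt0 : (0 < k)%N.

Lemma exists_is_min_of_argmax (a : 'I_k -> R) :
  exists2 l, forall i, a i <= a l &
    forall i, is_min_of (argmax a) i = (i == l).
Proof.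
pose i0 := Ordinal k_gt0.
have [j _ jmax] := arg_maxP a (isT : xpredT i0).
have jA : j \in argmax a by rewrite inE; apply/forallP => i; exact: jmax.
have [l lA lmin] := arg_minnP (fun i : 'I_k => val i) jA.
have ll : is_min_of (argmax a) l.
  by apply/andP; split; [exact: lA|apply/forall_inP => i; exact: lmin].
exists l.
  by move: (lA : l \in argmax a); rewrite inE => /forallP.
move=> i; apply/idP/eqP => [/andP[iA /forall_inP imin]|->//].
by apply/val_inj/eqP; rewrite eqn_leq imin// lmin.
Qed.

(** Each selection has weight 1 at exactly one index, so the left side is some entry of [a] and the
    right side is its largest entry. *)
Lemma sum_selection_le (a b : 'I_k -> R) :
  \sum_l (if is_min_of (argmax b) l then 1 else 0) * a l <=
  \sum_l (if is_min_of (argmax a) l then 1 else 0) * a l.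
Proof.
have sumE (c : 'I_k -> R) : exists2 l,
    \sum_l (if is_min_of (argmax c) l then 1 else 0) * a l = a l & forall i, c i <= c l.
  have [l lmax lE] := exists_is_min_of_argmax c; exists l => //.
  rewrite (bigD1 l)//= lE eqxx mul1r big1 ?addr0// => i /negbTE il.
  by rewrite lE il mul0r.
by have [l -> _] := sumE b; have [m -> mmax] := sumE a.
Qed.

End argmax_selection.

(** * Energy descent in [u] at fixed phi, then in phi at fixed [u] *)

Section descent.
Context (R : realType) (d k : nat) (Omega : set 'rV[R]_d) (tau : R).
Hypothesis k_gt0 : (0 < k)%N.
Hypothesis mOmega : measurable Omega.
Hypothesis Omega_lty : (lebesgue_rV d Omega < +oo)%E.
Hypothesis tau_gt0 : 0 < tau.
Local Notation mu := (@lebesgue_rV R d).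
Implicit Types phi u v : 'I_k -> 'rV[R]_d -> R.

Let tau2_gt0 : 0 < tau / 2. Proof. by rewrite divr_gt0. Qed.

Let mK := @measurable_heat_kernel_sub R d (tau / 2).
Let K_le := fun x y => @normr_heat_kernel_le R d (tau / 2) tau2_gt0 (x - y).
Let K_sym := @heat_kernel_subC R d (tau / 2).

Definition unit_fields u := forall l, unit_L2 mu Omega (u l).

Definition partition_like phi := forall l,
  measurable_fun Omega (phi l) /\
  \forall x \ae mu, Omega x -> 0 <= phi l x <= 1.

Lemma partition_like_is_partition phi u :
  is_partition Omega tau phi u -> partition_like phi.
Proof.
move=> phiu l; have [mphi phiE] := phiu l; split=> //.
apply: filterS phiE => x + Ox => /(_ Ox) ->; rewrite /partition_of.
by case: ifP => _; rewrite lexx ler01.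
Qed.

(** At fixed [phi] the components decouple: [power_step_monotone] shows that no subtracted integral
    decreases. *)
Lemma power_step_energy phi u u' :
  unit_fields u -> partition_like phi -> is_power_step Omega tau phi u u' ->
  unit_fields u' /\ energy Omega tau phi u' <= energy Omega tau phi u.
Proof.
move=> uu phip [def stepE].
have step l : unit_L2 mu Omega (u' l) /\
    \int[mu]_(x in Omega) (phi l x * heat_half Omega tau (u l) x ^+ 2) <=
    \int[mu]_(x in Omega) (phi l x * heat_half Omega tau (u' l) x ^+ 2).
  have [mphi phi01] := phip l; have [mu' u'E] := stepE l.
  apply: (power_step_monotone mOmega Omega_lty mK K_le K_sym mphi _ _ (uu l)).
  - by apply: filterS phi01 => x + Ox => /(_ Ox) /andP[].
  - by apply: filterS phi01 => x + Ox => /(_ Ox) /andP[].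
  - by have := def l; rewrite L2normE.
  - exact: mu'.
  - by move: u'E; rewrite /power_step L2normE.
split=> [l|]; first exact: (step l).1.
rewrite /energy lerD2l lerN2; apply: ler_sum => l _.
apply: ler_wpM2l; first by rewrite invr_ge0 ltW.
rewrite (@eq_Rintegral _ _ _ _ _
  (fun x => phi l x * heat_half Omega tau (u l) x ^+ 2)); last first.
  by move=> x _; rewrite real_normK ?num_real.
rewrite [leRHS](@eq_Rintegral _ _ _ _ _
  (fun x => phi l x * heat_half Omega tau (u' l) x ^+ 2)); last first.
  by move=> x _; rewrite real_normK ?num_real.
exact: (step l).2.
Qed.

Lemma inner_loop_energy tol phi u u' :
  unit_fields u -> partition_like phi -> inner_loop Omega tau tol phi u u' ->
  unit_fields u' /\ energy Omega tau phi u' <= energy Omega tau phi u.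
Proof.
move=> uu phip [w [M [w0 steps _ _ ->]]].
(* The induction covers all indices up to M + 1; the right-hand [M.+1] stays fixed, so every step
   taken starts at some m <= M, the range of [steps]. *)
have : (M.+1 <= M.+1)%N by [].
elim: {1 3 4}M.+1 => [_|m IH mM]; first by rewrite w0.
have [wm Em] := IH (ltnW mM).
have [wm1 Em1] := power_step_energy wm phip (steps m mM).
by split; [exact: wm1|exact: le_trans Em1 Em].
Qed.

(** At almost every point both partitions select a single component, and [psi] selects one with the
    largest |T u_l|^2. In the application [v] is the previous iterate. *)
Lemma partition_energy phi psi u v :
  unit_fields u -> is_partition Omega tau phi v -> is_partition Omega tau psi u ->
  energy Omega tau psi u <= energy Omega tau phi u.
Proof.
move=> uu phiv psiu; rewrite /energy lerD2l lerN2 -!mulr_sumr.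
apply: ler_wpM2l; first by rewrite invr_ge0 ltW.
have fi chi : partition_like chi -> forall l, mu.-integrable Omega
    (EFin \o (fun x => chi l x * `|heat_half Omega tau (u l) x| ^+ 2)).
  move=> chip l; have [mchi chi01] := chip l; have [mul u2i _] := uu l.
  have ui := integrable_of_sqr mOmega Omega_lty mul u2i.
  apply: eq_integrable (integrable_weight_kernel_opM mOmega Omega_lty mK K_le
    mchi _ _ ui ui) => //.
  - by move=> x _ /=; rewrite real_normK ?num_real// expr2.
  - by apply: filterS chi01 => x + Ox => /(_ Ox) /andP[].
  - by apply: filterS chi01 => x + Ox => /(_ Ox) /andP[].
have phii := fi _ (partition_like_is_partition phiv).
have psii := fi _ (partition_like_is_partition psiu).
(* The sum goes under the integral because the comparison holds only for the sum over l, not for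
   each component. *)
rewrite -!Rintegral_sum//; apply: ae_le_Rintegral => //.
- exact: integrable_sum_EFin.
- exact: integrable_sum_EFin.
(* The finitely many exceptional null sets, one for each l, are merged into one. *)
have allE (chi w : 'I_k -> 'rV[R]_d -> R) :
    is_partition Omega tau chi w -> \forall x \ae mu, Omega x ->
    forall l, chi l x = partition_of Omega tau w l x.
  move=> chiw.
  have : \forall x \ae mu, forall l, Omega x ->
      chi l x = partition_of Omega tau w l x.
    by apply: filter_forall => l; exact: (chiw l).2.
  by apply: filterS => x + Ox l => /(_ l Ox).
apply: filterS2 (allE _ _ phiv) (allE _ _ psiu) => x + + Ox => /(_ Ox) phiE /(_ Ox) psiE.
under eq_bigr do rewrite phiE.
under [leRHS]eq_bigr do rewrite psiE.
exact: sum_selection_le.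
Qed.

End descent.

Theorem theorem3p4 (R : realType) (d k : nat) (Omega : set 'rV[R]_d)
    (tau : R) (phi u : nat -> 'I_k -> 'rV[R]_d -> R)
    (d_ge2 : (2 <= d)%N) (k_ge2 : (2 <= k)%N)
    (Omega_bounded : bounded_set Omega) (Omega_open : open Omega)
    (Omega_connected : connected Omega)
    (tau_gt0 : 0 < tau)
    (run : algorithm1 Omega tau phi u \/
           exists2 tol : R, 0 < tol & algorithm2 Omega tau tol phi u)
    (s : nat) :
  energy Omega tau (phi s.+1) (u s.+1) <= energy Omega tau (phi s) (u s).
Proof.
have mOmega := measurable_open_rV Omega_open.
have Omega_lty := bounded_rV_measure_lty mOmega Omega_bounded.
have k_gt0 : (0 < k)%N by exact: leq_trans k_ge2.
(* Both algorithms are reduced to the same three facts; from here on they are treated together. *)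
have [u0 part outer] : [/\ unit_fields Omega (u 0%N),
    forall n, is_partition Omega tau (phi n) (u n) &
    forall n, unit_fields Omega (u n) -> unit_fields Omega (u n.+1) /\
      energy Omega tau (phi n) (u n.+1) <= energy Omega tau (phi n) (u n)].
  have unit0 : unit_spheres Omega (u 0%N) -> unit_fields Omega (u 0%N).
    by move=> H l; have [L2u u1] := H l; exact: unit_L2_of_L2.
  case: run => [[u0 step]|[tol _ [u0 step]]].
    split=> [|n|n un]; [exact: unit0|exact: (step n).1|].
    have [pn sn] := step n.
    exact: (power_step_energy mOmega Omega_lty tau_gt0 un
      (partition_like_is_partition pn) sn).
  split=> [|n|n un]; [exact: unit0|exact: (step n).1|].
  have [pn sn] := step n.
  exact: (inner_loop_energy mOmega Omega_lty tau_gt0 un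
    (partition_like_is_partition pn) sn).
have unit_u n : unit_fields Omega (u n).
  by elim: n => // n /outer[].
(* The intermediate energy is E(phi^s, u^(s+1)). *)
apply: le_trans (outer s (unit_u s)).2.
exact: (partition_energy k_gt0 mOmega Omega_lty tau_gt0 (unit_u s.+1)
  (part s) (part s.+1)).
Qed.
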